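(* Let $(X_i,\mathcal A_i,\nu_i)$, $i=1,2$, be standard $\sigma$-finite measure spaces, and let $P:X_1\times\mathcal A_2\to[0,\infty)$ and $Q:X_2\times\mathcal A_1\to[0,\infty)$ be finite transition kernels with $d\nu_1(x)P(x,dy)=d\nu_2(y)Q(y,dx)$. Let $T_P(g)(x)=\int_{X_2}P(x,dy)g(y)$ and $T_Q(f)(y)=\int_{X_1}Q(y,dx)f(x)$. (1) Let $c_1(x)=P(x,X_2)$. If $$M=\operatorname*{ess\,sup}_{y\in X_2}\int_{X_1}Q(y,dx)\,c_1(x)<\infty,$$ then the operator $T_P:L^2(\nu_2)\to L^2(\nu_1)$ is bounded and $\|T_P\|_{L^2(\nu_2)\to L^2(\nu_1)}\le M$. A similar statement holds for the operator $T_Q$ when the roles of $T_P$ and $T_Q$ are interchanged. (2) Suppose there are functions $a\in L^2(\nu_1)$ and $b\in L^2(\nu_2)$ such that $$\frac{P(x,dy)}{d\nu_2(y)}\le a(x)b(y).$$ Then $$\|T_P\|_{L^2(\nu_2)\to L^2(\nu_1)}\le\|a\|_{L^2(\nu_1)}\|b\|_{L^2(\nu_2)}.$$ A similar estimate holds for the norm of $T_Q$ if there are functions $a_1\in L^2(\nu_1)$ and $b_1\in L^2(\nu_2)$ such that $$\frac{Q(y,dx)}{d\nu_1(x)}\le a_1(x)b_1(y).$$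
   Context: A map $R:X\times\mathcal A'\to[0,\infty)$ (with $(X,\mathcal A)$, $(X',\mathcal A')$ standard Borel spaces) is a transition kernel if $x\mapsto R(x,C)$ is Borel for every $C\in\mathcal A'$ and $C\mapsto R(x,C)$ is a $\sigma$-finite Borel measure for every $x\in X$; it is finite if $0<R(x,X')<\infty$ for every $x$. The equality $d\nu_1(x)P(x,dy)=d\nu_2(y)Q(y,dx)$ means that both sides define the same measure on $X_1\times X_2$. In (2), $\frac{P(x,dy)}{d\nu_2(y)}$ denotes the Radon--Nikodym derivative of $P(x,\cdot)$ with respect to $\nu_2$ (for such a pair of kernels, $P(x,\cdot)\ll\nu_2$ for $\nu_1$-a.e. $x$), and similarly $\frac{Q(y,dx)}{d\nu_1(x)}$ for $Q(y,\cdot)$ and $\nu_1$; the inequalities are understood almost everywhere.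
   Formalization: In (1) the bound M, false for M<1 (one-point spaces, P=Q=1/2), is replaced by the square root of M, with the bound M kept when M≥1; likewise for T_Q. In (2), absolute continuity of P(x,·) (resp. Q(y,·)) for a.e. point, which can fail, is assumed so that the derivative exists. *)

(* Defs.v *)
From HB Require Import structures.
From mathcomp Require Import all_boot all_order all_algebra.
From mathcomp Require Import all_classical all_reals all_analysis.

Set Implicit Arguments.
Unset Strict Implicit.
Unset Printing Implicit Defensive.
Import Order.TTheory GRing.Theory Num.Theory.
Import numFieldNormedType.Exports.

Local Open Scope classical_set_scope.
Local Open Scope ring_scope.

(* The Borel space of a complete separable metric space; M may be empty. *)
Definition standard_borel (R : realType) (d : measure_display)
    (T : measurableType d) : Prop :=
  exists (M : metricType R) (f : T -> M),
    [/\ bijective f,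
        forall F : set_system M, ProperFilter F -> cauchy F ->
          exists x : M, F --> x,
        exists2 D : set M, countable D & dense D
      & forall A : set T, measurable A <-> <<s [set U : set M | open U] >> (f @` A)].

(* A finite transition kernel moreover charges the whole space from every
   point; R.-ftker only provides finiteness. *)
Definition positive_kernel (R : realType) (d1 d2 : measure_display)
    (X : measurableType d1) (Y : measurableType d2)
    (k : X -> {measure set Y -> \bar R}) : Prop :=
  forall x : X, (0 < k x [set: Y])%E.

(* nu1(dx) P(x, dy) = nu2(dy) Q(y, dx) as measures on the product space. *)
Definition dual_kernels (R : realType) (d1 d2 : measure_display)
    (X1 : measurableType d1) (X2 : measurableType d2)
    (nu1 : {measure set X1 -> \bar R}) (nu2 : {measure set X2 -> \bar R})
    (P : X1 -> {measure set X2 -> \bar R})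
    (Q : X2 -> {measure set X1 -> \bar R}) : Prop :=
  forall C : set (X1 * X2), measurable C ->
    (\int[nu1]_x P x (xsection C x) = \int[nu2]_y Q y (ysection C y))%E.

Definition kernel_op (R : realType) (d1 d2 : measure_display)
    (X : measurableType d1) (Y : measurableType d2)
    (k : X -> {measure set Y -> \bar R}) (g : Y -> R) : X -> R :=
  fun x => \int[k x]_y g y.

Notation L2norm mu f := (Lnorm mu 2%:E (EFin \o f)).

(* Elements of L^2 are represented by square-integrable measurable functions;
   T acts on representatives. *)
Definition L2_opnorm (R : realType) (d1 d2 : measure_display)
    (X : measurableType d1) (Y : measurableType d2)
    (nu : {measure set Y -> \bar R}) (mu : {measure set X -> \bar R})
    (T : (Y -> R) -> (X -> R)) : \bar R :=
  ereal_sup [set L2norm mu (T g) | g in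
    [set g : Y -> R | g \in Lfun nu 2%:E /\ (L2norm nu g <= 1)%E]].

(* T induces a bounded linear operator from L^2(nu) to L^2(mu), classes being
   taken modulo almost everywhere equality. *)
Definition bounded_L2_op (R : realType) (d1 d2 : measure_display)
    (X : measurableType d1) (Y : measurableType d2)
    (nu : {measure set Y -> \bar R}) (mu : {measure set X -> \bar R})
    (T : (Y -> R) -> (X -> R)) : Prop :=
  [/\ forall g : Y -> R, g \in Lfun nu 2%:E -> T g \in Lfun mu 2%:E,
      {in Lfun nu 2%:E &, forall g h : Y -> R,
        g = h %[ae nu] -> T g = T h %[ae mu]},
      forall c : R, {in Lfun nu 2%:E &, forall g h : Y -> R,
        T (c *: g + h) = c *: T g + T h %[ae mu]}
    & (L2_opnorm nu mu T < +oo)%E].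

(* Rintegral is 0 at points where the integral does not converge, hence the
   separate requirement that it converges almost everywhere. *)
Definition bounded_kernel_op (R : realType) (d1 d2 : measure_display)
    (X : measurableType d1) (Y : measurableType d2)
    (nu : {measure set Y -> \bar R}) (mu : {measure set X -> \bar R})
    (k : X -> {measure set Y -> \bar R}) : Prop :=
  {in Lfun nu 2%:E, forall g : Y -> R,
    {ae mu, forall x, (k x).-integrable [set: Y] (EFin \o g)}} /\
  bounded_L2_op nu mu (kernel_op k).

Definition kernel_fiber (R : realType) (d1 d2 : measure_display)
    (X : measurableType d1) (Y : measurableType d2) (k : R.-ftker X ~> Y)
    (x : X) : set Y -> \bar R := k x.

HB.instance Definition _ (R : realType) (d1 d2 : measure_display)
    (X : measurableType d1) (Y : measurableType d2) (k : R.-ftker X ~> Y)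
    (x : X) := Measure.copy (kernel_fiber k x) (k x).

HB.instance Definition _ (R : realType) (d1 d2 : measure_display)
    (X : measurableType d1) (Y : measurableType d2) (k : R.-ftker X ~> Y)
    (x : X) :=
  @Measure_isFinite.Build _ Y R (kernel_fiber k x) (kernel_finite_transition x).

(* The almost everywhere inequality k(x, dy) / nu(dy) <= a(x) b(y).  Outside
   absolute continuity the library's derivative is the constant -oo, so that
   the existence of the derivative has to be required explicitly. *)
Definition density_le (R : realType) (d1 d2 : measure_display)
    (X : measurableType d1) (Y : measurableType d2)
    (mu : {measure set X -> \bar R})
    (nu : {sigma_finite_measure set Y -> \bar R})
    (k : R.-ftker X ~> Y) (a : X -> R) (b : Y -> R) : Prop :=
  {ae mu, forall x, k x `<< nu /\
    {ae nu, forall y,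
      (Radon_Nikodym (charge_of_finite_measure (kernel_fiber k x)) nu y
        <= (a x * b y)%:E)%E}}.

(* Main.v *)
(* It is enough to bound the L^2 norm of g |-> \int k(x, dy) |g(y)| by K |g|:
   this makes the integral converge almost everywhere, and the bound itself,
   applied to a difference that vanishes almost everywhere, shows that the
   operator acts on classes.

   (1) By the Cauchy-Schwarz inequality for the finite measure P(x, .),
   (\int P(x, dy) |g(y)|)^2 <= c_1(x) \int P(x, dy) |g(y)|^2.  Integrating in
   nu_1 and exchanging the integrals by duality gives
   \int nu_2(dy) |g(y)|^2 \int Q(y, dx) c_1(x) <= M |g|^2.

   (2) The density bound and the Cauchy-Schwarz inequality for nu_2 give
   \int P(x, dy) |g(y)| <= |a(x)| |b| |g|. *)
Require Import Defs.
From HB Require Import structures.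
From mathcomp Require Import all_boot all_order all_algebra.
From mathcomp Require Import all_classical all_reals all_analysis.
From mathcomp Require Import ess_sup_inf measurable_realfun.

Set Implicit Arguments.
Unset Strict Implicit.
Unset Printing Implicit Defensive.
Import Order.TTheory GRing.Theory Num.Theory.
Import numFieldNormedType.Exports.

Local Open Scope classical_set_scope.
Local Open Scope ring_scope.
Local Open Scope ereal_scope.

(** * The measure mu(dx) k(x, dy) on the product space and integration against it *)

Section joint_measure.
Context d1 d2 (X : measurableType d1) (Y : measurableType d2) (R : realType).
Variables (mu : {measure set X -> \bar R}) (k : R.-ftker X ~> Y).

Lemma measurable_integral_kernel_pair (F : X * Y -> \bar R) :
  measurable_fun [set: X * Y] F -> (forall z, 0 <= F z) ->
  measurable_fun [set: X] (fun x => \int[k x]_y F (x, y)).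
Proof. exact: measurable_kfcomp. Qed.

Lemma measurable_kernel_xsection C : measurable C ->
  measurable_fun [set: X] (fun x => k x (xsection C x)).
Proof.
move=> mC; rewrite -kfcompkindic//; apply: measurable_kfcomp => //.
  by apply/measurable_EFinP; exact: measurable_indic.
by move=> t; rewrite /= lee_fin.
Qed.

(** This is either side of [dual_kernels], up to the order of the coordinates. As a measure on the
    product, it lets duality pass from sets to integrands. *)
Definition joint_measure (C : set (X * Y)) : \bar R :=
  \int[mu]_x k x (xsection C x).

Let joint_measure0 : joint_measure set0 = 0.
Proof.
by rewrite /joint_measure; under eq_integral do rewrite xsection0 measure0;
  rewrite integral0.
Qed.

Let joint_measure_ge0 C : 0 <= joint_measure C.
Proof. by apply: integral_ge0 => x _. Qed.

Let joint_measure_semi_sigma_additive : semi_sigma_additive joint_measure.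
Proof.
move=> F mF tF mUF.
(* Taking sections commutes with unions and preserves disjointness, so each [k x] is additive along
   the sections; the nonnegative series is then integrated term by term. *)
rewrite [X in _ --> X](_ : _ = \sum_(n <oo) joint_measure (F n)); last first.
  rewrite /joint_measure -integral_nneseries//; last first.
    by move=> n; exact: measurable_kernel_xsection.
  apply: eq_integral => x _; rewrite xsection_bigcup.
  rewrite measure_semi_bigcup//.
  - by move=> n; exact: measurable_xsection.
  - exact: trivIset_xsection.
  - by apply: bigcup_measurable => n _; exact: measurable_xsection.
by apply: is_cvg_nneseries.
Qed.

HB.instance Definition _ := isMeasure.Build _ _ _ joint_measure
  joint_measure0 joint_measure_ge0 joint_measure_semi_sigma_additive.

Let integral_joint_measure_indic C : measurable C ->
  \int[joint_measure]_z (\1_C z)%:E = \int[mu]_x \int[k x]_y (\1_C (x, y))%:E.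
Proof.
move=> mC; rewrite integral_indic// setIT /=.
apply: eq_integral => x _.
by rewrite -[LHS]/((fun x => k x (xsection C x)) x) -kfcompkindic.
Qed.

Import HBNNSimple.

Let measurable_pair (f : X * Y -> \bar R) x :
  measurable_fun setT f -> measurable_fun setT (fun y => f (x, y)).
Proof. by move=> mf; exact: measurableT_comp. Qed.

(** Linearity over the finitely many values of [h] reduces this to indicators. The intermediate
    expression has the finite sum between the two integrals. *)
Let integral_joint_measure_nnsfun (h : {nnsfun (X * Y) >-> R}) :
  \int[joint_measure]_z (h z)%:E = \int[mu]_x \int[k x]_y (h (x, y))%:E.
Proof.
have mh r : measurable_fun setT
    (fun z : X * Y => (r * \1_(h @^-1` [set r]) z)%:E).
  by apply/measurable_EFinP; exact: measurableT_comp.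
transitivity (\int[mu]_x
    \sum_(r \in range h) \int[k x]_y (r * \1_(h @^-1` [set r]) (x, y))%:E).
  rewrite ge0_integral_fsum//; last 2 first.
  - move=> r; apply: (measurable_integral_kernel_pair
        (F := fun z => (r * \1_(h @^-1` [set r]) z)%:E)).
      exact: mh.
    by move=> z; rewrite EFinM nnfun_muleindic_ge0.
  - move=> r x _; apply: integral_ge0 => y _.
    by rewrite EFinM nnfun_muleindic_ge0.
  under eq_integral do rewrite fimfunE -fsumEFin//.
  rewrite ge0_integral_fsum//; last first.
    by move=> r z _; rewrite EFinM nnfun_muleindic_ge0.
  (* Writing [r] as a value [h z] makes it nonnegative, which allows it to be pulled out of the
     integrals. *)
  apply: eq_fsbigr => r /set_mem [z _ <-{r}].
  under eq_integral do rewrite EFinM.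
  rewrite ge0_integralZl//; last 2 first.
  - by apply/measurable_EFinP; exact: measurable_indic.
  - by rewrite lee_fin.
  rewrite integral_joint_measure_indic// -ge0_integralZl//; last 3 first.
  - apply: (measurable_integral_kernel_pair
        (F := fun z' => (\1_(h @^-1` [set h z]) z')%:E)) => //.
    by apply/measurable_EFinP; exact: measurable_indic.
  - by move=> x _; exact: integral_ge0.
  - by rewrite lee_fin.
  apply: eq_integral => x _; rewrite -ge0_integralZl//.
  - apply: (measurable_pair (f := fun z' => (\1_(h @^-1` [set h z]) z')%:E)).
    by apply/measurable_EFinP; exact: measurable_indic.
  - by rewrite lee_fin.
apply: eq_integral => x _.
under [RHS]eq_integral do rewrite fimfunE -fsumEFin//.
rewrite ge0_integral_fsum//.
- move=> r.
  exact: (measurable_pair (f := fun z => (r * \1_(h @^-1` [set r]) z)%:E)).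
- by move=> r y _; rewrite EFinM nnfun_muleindic_ge0.
Qed.

(** Monotone convergence along simple approximations of [F] is used three times: in [y] for fixed
    [x], then in [x], and finally for the joint measure. *)
Lemma integral_joint_measure (F : X * Y -> \bar R) :
  measurable_fun setT F -> (forall z, 0 <= F z) ->
  \int[joint_measure]_z F z = \int[mu]_x \int[k x]_y F (x, y).
Proof.
move=> mF F0; pose h := nnsfun_approx measurableT mF.
have mh n : measurable_fun setT (fun z => (h n z)%:E) by exact/measurable_EFinP.
have nd_h z : {homo (fun n => (h n z)%:E) : a b / (a <= b)%N >-> a <= b}.
  by move=> a b ab; rewrite lee_fin; exact/lefP/nd_nnsfun_approx.
have h_cvg z : (h n z)%:E @[n --> \oo] --> F z by exact: cvg_nnsfun_approx.
have h0 n z : 0 <= (h n z)%:E by rewrite lee_fin.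
have intk x : \int[k x]_y F (x, y) =
    lim (\int[k x]_y (h n (x, y))%:E @[n --> \oo]).
  rewrite -monotone_convergence//; last first.
    by move=> n; exact: (measurable_pair (f := fun z => (h n z)%:E)).
  by apply: eq_integral => y _; apply/esym/cvg_lim.
under [RHS]eq_integral do rewrite intk.
rewrite monotone_convergence//; last 3 first.
- by move=> n; exact: (measurable_integral_kernel_pair (F := fun z => (h n z)%:E)).
- by move=> n x _; exact: integral_ge0.
- move=> x _ a b ab; apply: ge0_le_integral => //.
  + exact: (measurable_pair (f := fun z => (h a z)%:E)).
  + exact: (measurable_pair (f := fun z => (h b z)%:E)).
  + by move=> y _; exact: nd_h.
rewrite -(_ : (fun n => \int[joint_measure]_z (h n z)%:E) = fun n => _); last first.
  by apply/funext => n; rewrite integral_joint_measure_nnsfun.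
rewrite -monotone_convergence//.
by apply: eq_integral => z _; apply/esym/cvg_lim.
Qed.

End joint_measure.

(** Both sides are integrals against joint measures. Duality says that the joint measure of [nu2]
    and [Q], pushed forward by the exchange of coordinates, agrees with that of [nu1] and [P] on
    measurable sets. *)
Lemma dual_kernels_integral d1 d2 (X1 : measurableType d1)
    (X2 : measurableType d2) (R : realType)
    (nu1 : {measure set X1 -> \bar R}) (nu2 : {measure set X2 -> \bar R})
    (P : R.-ftker X1 ~> X2) (Q : R.-ftker X2 ~> X1) (F : X1 * X2 -> \bar R) :
  dual_kernels nu1 nu2 P Q ->
  measurable_fun setT F -> (forall z, 0 <= F z) ->
  \int[nu1]_x \int[P x]_y F (x, y) = \int[nu2]_y \int[Q y]_x F (x, y).
Proof.
move=> PQ mF F0; pose swap (z : X2 * X1) := (z.2, z.1).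
have mswap : measurable_fun setT swap by exact: measurable_fun_pair.
rewrite -integral_joint_measure//.
transitivity (\int[joint_measure nu2 Q]_z F (swap z)); last first.
  by rewrite integral_joint_measure//; exact: measurableT_comp.
have := ge0_integral_pushforward mswap (joint_measure nu2 Q) measurableT mF
  (fun z _ => F0 z).
rewrite preimage_setT => <-; apply: eq_measure_integral => C mC _ /=.
by rewrite /pushforward /= /joint_measure PQ.
Qed.

(** * Monotonicity and finiteness properties of the L^2 norm *)

Section Lnorm2.
Context d (X : measurableType d) (R : realType).
Variable mu : {measure set X -> \bar R}.

Lemma le_Lnorm2 (f g : X -> \bar R) :
  measurable_fun setT f -> measurable_fun setT g ->
  {ae mu, forall x, `|f x| <= `|g x|} ->
  Lnorm mu 2%:E f <= Lnorm mu 2%:E g.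
Proof.
move=> mf mg fg; rewrite unlock gt0_ler_poweR//.
- by rewrite in_itv/= leey integral_ge0// => x _; rewrite poweR_ge0.
- by rewrite in_itv/= leey integral_ge0// => x _; rewrite poweR_ge0.
have m2 h : measurable_fun setT h ->
    measurable_fun setT (fun x : X => `|h x| `^ 2).
  move=> mh; apply: (measurableT_comp (measurable_poweR 2%R)).
  exact: measurableT_comp.
apply: ae_ge0_le_integral => //.
- by move=> x _; exact: poweR_ge0.
- exact: m2.
- by move=> x _; exact: poweR_ge0.
- exact: m2.
apply: filterS fg => x fg _; rewrite gt0_ler_poweR//.
- by rewrite in_itv/= leey abse_ge0.
- by rewrite in_itv/= leey abse_ge0.
Qed.

Lemma Lnorm2_le (f : X -> \bar R) (c : \bar R) : 0 <= c ->
  \int[mu]_x `|f x| `^ 2 <= c `^ 2 -> Lnorm mu 2%:E f <= c.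
Proof.
move=> c0 fc; rewrite unlock (_ : c = (c `^ 2) `^ 2^-1); last first.
  by rewrite -poweRrM mulfV// poweRe1.
rewrite gt0_ler_poweR//.
- by rewrite in_itv/= leey integral_ge0// => x _; rewrite poweR_ge0.
- by rewrite in_itv/= leey poweR_ge0.
Qed.

(** A finite norm makes the square of [f] integrable, hence finite almost everywhere. This is how a
    norm bound yields convergence of the kernel integrals. *)
Lemma Lnorm2_lty_ae_lty (f : X -> \bar R) : measurable_fun setT f ->
  Lnorm mu 2%:E f < +oo -> {ae mu, forall x, `|f x| < +oo}.
Proof.
move=> mf; rewrite unlock => /lty_poweRy; rewrite invr_eq0 pnatr_eq0 => /(_ isT) f2.
have : mu.-integrable setT (fun x => `|f x| `^ 2).
  apply/integrableP; split.
    apply: (measurableT_comp (measurable_poweR 2%R)).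
    exact: measurableT_comp.
  by under eq_integral do rewrite gee0_abs ?poweR_ge0//.
move/(integrable_ae measurableT); apply: filterS => x /(_ I).
by rewrite ge0_fin_numE ?poweR_ge0// => /lty_poweRy; rewrite pnatr_eq0; exact.
Qed.

Lemma Lfun_measurable (p : \bar R) (f : X -> R) :
  f \in Lfun mu p -> measurable_fun setT f.
Proof. by rewrite inE => /andP[/[!inE]]. Qed.

Lemma Lfun_lty (p : \bar R) (f : X -> R) :
  f \in Lfun mu p -> Lnorm mu p (EFin \o f) < +oo.
Proof. by rewrite inE => /andP[_]; rewrite inE. Qed.

End Lnorm2.

(** * From a norm estimate with absolute values to a bounded operator on L^2 *)

Section kernel_op_bound.
Context d1 d2 (X : measurableType d1) (Y : measurableType d2) (R : realType).
Variables (mu : {measure set X -> \bar R}) (nu : {measure set Y -> \bar R}).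
Variable k : R.-ftker X ~> Y.

Let absop (g : Y -> R) x := \int[k x]_y `|(g y)%:E|.

Let absop_ge0 g x : 0 <= absop g x.
Proof. exact: integral_ge0. Qed.

Lemma measurable_kernel_op_abs (g : Y -> R) : measurable_fun setT g ->
  measurable_fun [set: X] (fun x => \int[k x]_y `|(g y)%:E|).
Proof.
move=> mg; apply: measurable_fun_integral_kernel => //.
- by move=> U mU; exact: measurable_kernel.
- by apply: measurableT_comp => //; exact/measurable_EFinP.
Qed.

(** The positive and negative parts of [g] have integrals measurable in [x]; applying [fine] to
    their difference gives the operator even where the integral diverges. *)
Lemma measurable_kernel_op (g : Y -> R) : measurable_fun setT g ->
  measurable_fun setT (kernel_op k g).
Proof.
move=> mg; apply: (measurableT_comp (@fine_measurable _ setT measurableT)).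
have mEg : measurable_fun setT (EFin \o g) by exact/measurable_EFinP.
rewrite [X in measurable_fun _ X](_ : _ = fun x =>
    \int[k x]_y ((EFin \o g)^\+ y) - \int[k x]_y ((EFin \o g)^\- y)); last first.
  by apply/funext => x; rewrite integralE.
apply: emeasurable_funB; apply: measurable_fun_integral_kernel => //.
- by move=> U mU; exact: measurable_kernel.
- exact: measurable_funepos.
- by move=> U mU; exact: measurable_kernel.
- exact: measurable_funeneg.
Qed.

Lemma abse_kernel_op_le (g : Y -> R) x : measurable_fun setT g ->
  `|(kernel_op k g x)%:E| <= \int[k x]_y `|(g y)%:E|.
Proof.
move=> mg; apply: (@le_trans _ _ `|\int[k x]_y (g y)%:E|).
  (* Where the integral is infinite, [fine] returns 0 and the inequality is trivial. *)
  by rewrite /kernel_op /Rintegral; case: (\int[k x]_y (g y)%:E) => //=;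
    rewrite leey.
by apply: le_abse_integral => //; exact/measurable_EFinP.
Qed.

Lemma bounded_kernel_op_of_le (K : \bar R) : 0 <= K -> K < +oo ->
  {in Lfun nu 2%:E, forall g : Y -> R,
    Lnorm mu 2%:E (fun x => \int[k x]_y `|(g y)%:E|) <= K * L2norm nu g} ->
  bounded_kernel_op nu mu k /\ L2_opnorm nu mu (kernel_op k) <= K.
Proof.
move=> K0 Koo Kle.
have Kfin : K \is a fin_num by rewrite ge0_fin_numE.
have absop_lty g : g \in Lfun nu 2%:E -> Lnorm mu 2%:E (absop g) < +oo.
  move=> Lg; apply: (le_lt_trans (Kle _ Lg)).
  by apply: lte_mul_pinfty => //; exact: Lfun_lty Lg.
have ae_int g : g \in Lfun nu 2%:E ->
    {ae mu, forall x, (k x).-integrable [set: Y] (EFin \o g)}.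
  move=> Lg; have mg := Lfun_measurable Lg.
  have := Lnorm2_lty_ae_lty (measurable_kernel_op_abs mg) (absop_lty _ Lg).
  apply: filterS => x; rewrite gee0_abs ?integral_ge0// => goo.
  by apply/integrableP; split => //; exact/measurable_EFinP.
have op_le g : g \in Lfun nu 2%:E ->
    L2norm mu (kernel_op k g) <= K * L2norm nu g.
  move=> Lg; have mg := Lfun_measurable Lg.
  apply: le_trans (Kle _ Lg); apply: le_Lnorm2.
  - by apply/measurable_EFinP; exact: measurable_kernel_op.
  - exact: measurable_kernel_op_abs.
  - apply/nearW => x /=; rewrite [leRHS]gee0_abs; last exact: absop_ge0.
    exact: abse_kernel_op_le.
have opnorm_le : L2_opnorm nu mu (kernel_op k) <= K.
  apply: ge_ereal_sup => _ [g [Lg g1] <-].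
  apply: (le_trans (op_le _ Lg)).
  by rewrite -[leRHS]mule1 lee_pmul// Lnorm_ge0.
split => //; split; first exact: ae_int.
split; last exact: le_lt_trans Koo.
- move=> g Lg; rewrite inE; apply/andP; split; rewrite inE/=.
    by apply: measurable_kernel_op; exact: Lfun_measurable Lg.
  rewrite /finite_norm (le_lt_trans (op_le _ Lg))//.
  by apply: lte_mul_pinfty => //; exact: Lfun_lty Lg.
- move=> g h Lg Lh gh.
  have Lgh : (g - h)%R \in Lfun nu 2%:E.
    rewrite addrC -scaleN1r.
    exact: (Lfun_submod_closed _ (lee1n 2)).2.
  have Ngh : L2norm nu (g - h)%R = 0.
    apply/eqP; rewrite eq_le Lnorm_ge0 andbT.
    rewrite -(@Lnorm0 _ _ _ nu 2%:E)//; apply: le_Lnorm2 => //.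
      by apply/measurable_EFinP; exact: Lfun_measurable Lgh.
    by apply: filterS gh => y /(_ I) ghy /=; rewrite fctE ghy subrr.
  have mgh := Lfun_measurable Lgh.
  have : absop (g - h)%R = \0 %[ae mu].
    apply: (@Lnorm_eq0_eq0 _ _ _ _ _ 2%:E) => //.
      exact: measurable_kernel_op_abs.
    by apply/eqP; rewrite eq_le Lnorm_ge0 andbT -(mule0 K) -Ngh Kle.
  (* Where both integrals converge, the difference of the images is the integral of [g - h], which
     is dominated by [absop (g - h)], that is, by 0. *)
  move: (ae_int _ Lg) (ae_int _ Lh); apply: filterS3 => x ig ih /(_ I) gh0 _.
  apply/eqP; rewrite -subr_eq0 /kernel_op -RintegralB//.
  have := abse_kernel_op_le x mgh; rewrite -/(absop _ x) gh0 /=.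
  by rewrite lee_fin normr_le0.
- move=> c g h Lg Lh.
  move: (ae_int _ Lg) (ae_int _ Lh); apply: filterS2 => x ig ih _.
  rewrite /kernel_op RintegralD//; first by rewrite RintegralZl.
  by rewrite (_ : _ \o _ = (fun y => c%:E * (EFin \o g) y)) ?integrableZl//.
Qed.
End kernel_op_bound.

(** * The Schur test for a dual pair of kernels *)

Lemma sqr_integral_abse_le d (T : measurableType d) (R : realType)
    (mu : {measure set T -> \bar R}) (g : T -> R) : measurable_fun setT g ->
  (\int[mu]_x `|(g x)%:E|) `^ 2 <= mu setT * \int[mu]_x `|(g x)%:E| `^ 2.
Proof.
move=> mg; have half : (2^-1 + 2^-1 = 1 :> R)%R by rewrite [RHS]splitr !div1r.
have two_gt0 : (0 < 2 :> R)%R by [].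
(* The first factor is the constant 1, whose squared norm is the total mass of [mu]. *)
have := @hoelder _ _ _ mu (cst 1%R) g 2 2 (measurable_cst _) mg
  two_gt0 two_gt0 half.
rewrite Lnorm1 (_ : \int[mu]_x _ = \int[mu]_x `|(g x)%:E|); last first.
  by apply: eq_integral => x _; rewrite /= mul1r.
move=> /(gt0_ler_poweR (ltW two_gt0)) => /(_ _ _)/le_trans.
apply.
- by rewrite in_itv/= leey integral_ge0.
- by rewrite in_itv/= leey mule_ge0 ?Lnorm_ge0.
rewrite poweRM ?Lnorm_ge0// !poweR_Lnorm//.
under eq_integral do rewrite /= normr1 powR1.
by rewrite integral_cst// mul1e.
Qed.

Lemma poweR2_sqrte (R : realType) (x : \bar R) : 0 <= x -> (sqrte x) `^ 2 = x.
Proof.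
by move=> x0; rewrite -poweR12_sqrt// -poweRrM mulVf// poweRe1.
Qed.

Section dual_kernels.
Context d1 d2 (X1 : measurableType d1) (X2 : measurableType d2) (R : realType).
Variables (nu1 : {measure set X1 -> \bar R}) (nu2 : {measure set X2 -> \bar R}).
Variables (P : R.-ftker X1 ~> X2) (Q : R.-ftker X2 ~> X1).
Hypothesis PQ : dual_kernels nu1 nu2 P Q.

Lemma dual_kernels_sym : dual_kernels nu2 nu1 Q P.
Proof.
move=> C mC; apply: esym.
(* Exchanging the coordinates turns horizontal sections of [C] into vertical ones, by conversion. *)
apply: (PQ (C := (fun z => (z.2, z.1)) @^-1` C)).
rewrite -[X in measurable X]setTI.
by apply: (measurable_fun_pair (f := snd) (g := fst)).
Qed.

Lemma schur_Lnorm2_le (M : \bar R) (g : X2 -> R) : 0 <= M ->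
  {ae nu2, forall y, \int[Q y]_x P x [set: X2] <= M} ->
  measurable_fun setT g ->
  Lnorm nu1 2%:E (fun x => \int[P x]_y `|(g y)%:E|) <= sqrte M * L2norm nu2 g.
Proof.
move=> M0 QM mg.
have mg2 : measurable_fun setT (fun y => `|(g y)%:E| `^ 2).
  apply: (measurableT_comp (measurable_poweR 2%R)).
  by apply: measurableT_comp => //; exact/measurable_EFinP.
have mc : measurable_fun [set: X1] (fun x => P x [set: X2]).
  exact: measurable_kernel.
have g20 y : 0 <= `|(g y)%:E| `^ 2 by exact: poweR_ge0.
apply: Lnorm2_le; first by rewrite mule_ge0 ?sqrte_ge0 ?Lnorm_ge0.
rewrite poweRM ?sqrte_ge0 ?Lnorm_ge0// poweR2_sqrte// poweR_Lnorm//.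
(* Integrated first in [y] against [P x], [F] gives the Cauchy-Schwarz bound at [x]; integrated
   first in [x] against [Q y], it gives the squared modulus of [g y] times the quantity bounded by
   [M]. *)
pose F (z : X1 * X2) := P z.1 [set: X2] * `|(g z.2)%:E| `^ 2.
have mF : measurable_fun setT F.
  apply: emeasurable_funM.
    exact: (measurableT_comp mc measurable_fst).
  exact: (measurableT_comp mg2 measurable_snd).
have F0 z : 0 <= F z by rewrite mule_ge0.
apply: (@le_trans _ _ (\int[nu1]_x \int[P x]_y F (x, y))).
  apply: ge0_le_integral => //.
  - by move=> x _; exact: poweR_ge0.
  - apply: (measurableT_comp (measurable_poweR 2%R)).
    by apply: measurableT_comp => //; exact: measurable_kernel_op_abs.
  - exact: measurable_integral_kernel_pair.
  - move=> x _; rewrite gee0_abs ?integral_ge0// /F /= ge0_integralZl//.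
    exact: sqr_integral_abse_le.
rewrite (dual_kernels_integral PQ)// -ge0_integralZl//; last first.
  by move=> y _; exact: g20.
apply: ae_ge0_le_integral => //.
- by move=> y _; exact: integral_ge0.
- by apply: (measurable_integral_kernel_pair Q (F := fun z => F (z.2, z.1))) => //;
    apply: (measurableT_comp mF); exact: measurable_fun_pair.
- by move=> y _; rewrite mule_ge0// g20.
- exact: measurable_funeM.
apply: filterS QM => y QM _.
by rewrite /F /= ge0_integralZr// lee_pmul// integral_ge0.
Qed.

Lemma schur_test :
  let M := ess_sup nu2 (fun y => \int[Q y]_x P x [set: X2]) in
  M < +oo ->
  [/\ bounded_kernel_op nu2 nu1 P,
      L2_opnorm nu2 nu1 (kernel_op P) <= sqrte M
    & 1 <= M -> L2_opnorm nu2 nu1 (kernel_op P) <= M].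
Proof.
move=> M Moo.
(* M is -oo when nu2 = 0. *)
have -> : sqrte M = sqrte (maxe M 0).
  have [//|M0] := leP 0 M.
  (* [sqrte] takes the value 0 at negative arguments. *)
  rewrite sqrte0; move: M M0 {Moo} => [r| |]//=.
  by rewrite lte_fin => /ltW/ler0_sqrtr ->.
have M0 : 0 <= maxe M 0 by rewrite le_max lexx orbT.
have M'oo : maxe M 0 < +oo by rewrite gt_max Moo ltry.
have [|||Pb PM] := @bounded_kernel_op_of_le _ _ _ _ _ nu1 nu2 P (sqrte (maxe M 0)).
- exact: sqrte_ge0.
- by rewrite -ge0_fin_numE ?sqrte_ge0// sqrte_fin_num// ge0_fin_numE.
- move=> g Lg; apply: schur_Lnorm2_le => //; last exact: Lfun_measurable Lg.
  apply: filterS (ess_sup_ge nu2 (fun y => \int[Q y]_x P x [set: X2])) => y.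
  by rewrite le_max => ->.
split => // M1; apply: (le_trans PM).
have M0' : 0 <= M by exact: le_trans M1.
(* [M] is rewritten as the root of its square, leaving [M <= M * M], which follows from [1 <= M]. *)
rewrite (max_idPl M0') -[leRHS](gee0_abs M0') -sqrte_sqr lee_sqrt ?sqre_ge0//.
by rewrite expe2 lee_pemulr.
Qed.

End dual_kernels.

(** * Kernels with a density dominated by a product of L^2 functions *)

Section density.
Context d1 d2 (X : measurableType d1) (Y : measurableType d2) (R : realType).
Variables (mu : {measure set X -> \bar R}).
Variables (nu : {sigma_finite_measure set Y -> \bar R}).
Variables (k : R.-ftker X ~> Y) (a : X -> R) (b : Y -> R).
Hypotheses (La : a \in Lfun mu 2%:E) (Lb : b \in Lfun nu 2%:E).

Lemma integral_density_le (x : X) (g : Y -> R) : k x `<< nu ->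
  {ae nu, forall y,
    Radon_Nikodym (charge_of_finite_measure (kernel_fiber k x)) nu y
      <= (a x * b y)%:E} ->
  measurable_fun setT g ->
  \int[k x]_y `|(g y)%:E| <= `|a x|%:E * (L2norm nu b * L2norm nu g).
Proof.
move=> kxnu kxab mg; have mb := Lfun_measurable Lb.
have mg' : measurable_fun setT (fun y => `|(g y)%:E|).
  by apply: measurableT_comp => //; exact/measurable_EFinP.
have half : (2^-1 + 2^-1 = 1 :> R)%R by rewrite [RHS]splitr !div1r.
apply: (@le_trans _ _ (`|a x|%:E * Lnorm nu 1 (EFin \o (b \* g)%R))); last first.
  by rewrite lee_pmul ?lee_fin ?Lnorm_ge0//; apply: hoelder.
(* This version of the derivative is nonnegative everywhere and supports the change of variables; it
   is identified below, almost everywhere, with the [Radon_Nikodym] of the hypothesis. *)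
pose f := Radon_Nikodym_SigmaFinite.f (kernel_fiber k x) nu.
have -> : \int[k x]_y `|(g y)%:E| = \int[nu]_y (`|(g y)%:E| * f y).
  by rewrite Radon_Nikodym_SigmaFinite.change_of_variables.
have mf : measurable_fun setT f.
  exact: measurable_int (Radon_Nikodym_SigmaFinite.f_integrable _).
have f0 y : 0 <= f y by exact: Radon_Nikodym_SigmaFinite.f_ge0.
have mbg : measurable_fun setT (fun y => `|(b y * g y)%:E|).
  by apply: measurableT_comp => //; apply/measurable_EFinP; exact: measurable_funM.
rewrite Lnorm1 -ge0_integralZl//.
apply: ae_ge0_le_integral => //.
- by move=> y _; rewrite mule_ge0.
- exact: emeasurable_funM.
- exact: measurable_funeM.
have := ae_eq_Radon_Nikodym_SigmaFinite (nu := kernel_fiber k x) kxnu measurableT.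
move: kxab; apply: filterS2 => y kxab /(_ I) fE _.
(* The product [a x * b y] may be negative at some points, so it is replaced by its absolute
   value. *)
rewrite /= normrM EFinM muleA [leRHS]muleC lee_pmul//.
by rewrite /f fE -EFinM -normrM (le_trans kxab)// lee_fin ler_norm.
Qed.

Lemma density_le_bounded_kernel_op : density_le mu nu k a b ->
  bounded_kernel_op nu mu k /\
  L2_opnorm nu mu (kernel_op k) <= L2norm mu a * L2norm nu b.
Proof.
move=> kab; apply: bounded_kernel_op_of_le.
- by rewrite mule_ge0 ?Lnorm_ge0.
- apply: lte_mul_pinfty; rewrite ?Lnorm_ge0 ?ge0_fin_numE ?Lnorm_ge0//.
    exact: Lfun_lty La.
  exact: Lfun_lty Lb.
move=> g Lg; have mg := Lfun_measurable Lg.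
have Cfin : L2norm nu b * L2norm nu g \is a fin_num.
  by rewrite fin_numM// ge0_fin_numE ?Lnorm_ge0//; exact: Lfun_lty.
have C0 : 0 <= L2norm nu b * L2norm nu g by rewrite mule_ge0 ?Lnorm_ge0.
(* The finite constant formed by the norms of [b] and [g] is absorbed into [a], so that the claim
   becomes an almost everywhere comparison with a multiple of [a]. *)
have NE := LnormZ (Lfun_Sub (lee1n 2) La) (fine (L2norm nu b * L2norm nu g)).
rewrite -muleA muleC -[X in _ <= X * _]fineK//.
rewrite -[X in _ <= X%:E * _]ger0_norm ?fine_ge0//.
rewrite -NE; apply: le_Lnorm2.
- exact: measurable_kernel_op_abs.
- by apply/measurable_EFinP; apply: measurable_funM => //; exact: Lfun_measurable La.
apply: filterS kab => x [kxnu kxab].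
rewrite gee0_abs ?integral_ge0//.
apply: (le_trans (integral_density_le kxnu kxab mg)).
by rewrite /= normrM EFinM muleC ger0_norm ?fine_ge0// fineK.
Qed.

End density.

(* The bound by M itself fails when M < 1: on one-point spaces with unit
   masses and P = Q = c one has M = c ^+ 2 and norm c.  The general bound is
   the square root of M, which yields the bound by M as soon as 1 <= M. *)
Theorem proposition6p9 (R : realType) (d1 d2 : measure_display)
    (X1 : measurableType d1) (X2 : measurableType d2)
    (nu1 : {sigma_finite_measure set X1 -> \bar R})
    (nu2 : {sigma_finite_measure set X2 -> \bar R})
    (P : R.-ftker X1 ~> X2) (Q : R.-ftker X2 ~> X1)
    (sbX1 : standard_borel R X1) (sbX2 : standard_borel R X2)
    (P_gt0 : positive_kernel P) (Q_gt0 : positive_kernel Q)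
    (PQ : dual_kernels nu1 nu2 P Q) :
  ((let M := ess_sup nu2 (fun y => \int[Q y]_x P x [set: X2]) in
    M < +oo ->
    [/\ bounded_kernel_op nu2 nu1 P,
        L2_opnorm nu2 nu1 (kernel_op P) <= sqrte M
      & 1 <= M -> L2_opnorm nu2 nu1 (kernel_op P) <= M]) /\
   (let M := ess_sup nu1 (fun x => \int[P x]_y Q y [set: X1]) in
    M < +oo ->
    [/\ bounded_kernel_op nu1 nu2 Q,
        L2_opnorm nu1 nu2 (kernel_op Q) <= sqrte M
      & 1 <= M -> L2_opnorm nu1 nu2 (kernel_op Q) <= M])) /\
  ((forall (a : X1 -> R) (b : X2 -> R),
      a \in Lfun nu1 2%:E -> b \in Lfun nu2 2%:E ->
      density_le nu1 nu2 P a b ->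
      bounded_kernel_op nu2 nu1 P /\
      L2_opnorm nu2 nu1 (kernel_op P) <= L2norm nu1 a * L2norm nu2 b) /\
   (forall (a1 : X1 -> R) (b1 : X2 -> R),
      a1 \in Lfun nu1 2%:E -> b1 \in Lfun nu2 2%:E ->
      density_le nu2 nu1 Q b1 a1 ->
      bounded_kernel_op nu1 nu2 Q /\
      L2_opnorm nu1 nu2 (kernel_op Q) <= L2norm nu1 a1 * L2norm nu2 b1)).
Proof.
split; split.
- exact: schur_test.
- exact/schur_test/dual_kernels_sym.
- by move=> a b La Lb; exact: density_le_bounded_kernel_op.
- by move=> a1 b1 La1 Lb1 Q1; rewrite muleC; exact: density_le_bounded_kernel_op.
Qed.
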